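(* Let $\mathcal{X}$ be a stochastic, irreducible and aperiodic homogeneous discrete-time Markov chain on a countably infinite state space $S$ with 1-step transition probabilities $P(i,j)$, $i,j\in S$. If $\mathcal{X}$ is simple and there is a $\delta>0$ such that $P(i,i)\ge\delta$ for all but finitely many states $i\in S$, then $\mathcal{X}$ is asymptotically aperiodic.
   Context: $\mathcal{X}=\{X(n),\,n=0,1,\dots\}$ has an arbitrary initial distribution, and $\mathbb{P}$ is the induced probability measure on sample paths. For $m\ge 1$, $\mathcal{X}^{(m)}=\{X^{(m)}(n)=X(nm),\ n=0,1,\dots\}$ is the $m$-step chain. For a Markov chain $\mathcal{Y}=\{Y(n)\}$ on $S$ (here $\mathcal{X}$ or some $\mathcal{X}^{(m)}$) and $C\subset S$ let $U(C)=\{Y(n)\in C \text{ for infinitely many } n\}$ and $L(C)=\{Y(n)\in C\text{ for all sufficiently large }n\}$. $C$ is transient (w.r.t. $\mathcal{Y}$) if $\mathbb{P}(U(C))=0$; regular if $\mathbb{P}(U(C)\setminus L(C))=0$; almost closed if it is regular and not transient. These notions do not depend on the initial distribution. An almost closed set is atomic if it does not contain two disjoint almost closed subsets, and nonatomic otherwise. Two regular sets are equivalent if their symmetric difference is transient. A Blackwell decomposition of $S$ for $\mathcal{Y}$ is a finite or countable collection $\{C_1,C_2,\dots\}$ of disjoint almost closed sets such that (i) every $C_i$, except at most one, is atomic; (ii) the nonatomic $C_i$, if present, contains no atomic subsets and consists of transient states; (iii) $\sum_i\mathbb{P}(L(C_i))=1$. By a theorem of Blackwell such a decomposition exists and is unique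 up to equivalence; $\beta(\mathcal{Y})$ denotes the number of sets in it. $\mathcal{Y}$ is simple if $\beta(\mathcal{Y})=1$. The asymptotic period of a simple chain $\mathcal{X}$ is $d(\mathcal{X}):=\sup\{m\ge1 : \beta(\mathcal{X}^{(m)})=m\}\in\{1,2,\dots\}\cup\{\infty\}$; $\mathcal{X}$ is asymptotically aperiodic if $d(\mathcal{X})=1$. *)

(* Defs.v *)
From mathcomp Require Import all_boot all_order all_algebra.
From mathcomp Require Import all_classical all_reals all_analysis.

Set Implicit Arguments.
Unset Strict Implicit.
Unset Printing Implicit Defensive.

Import Order.TTheory GRing.Theory Num.Theory.

Local Open Scope classical_set_scope.
Local Open Scope ring_scope.
Local Open Scope ereal_scope.

Section transition_probabilities.
Context {R : realType} {S : countType}.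
Variable P : S -> S -> R.

Definition stochastic :=
  (forall i j, (0 <= P i j)%R) /\
  (forall i, \esum_(j in [set: S]) (P i j)%:E = 1).

Fixpoint nstep (n : nat) (i j : S) : \bar R :=
  if n is n'.+1 then \esum_(k in [set: S]) ((P i k)%:E * nstep n' k j)
  else if i == j then 1 else 0.

Definition irreducible := forall i j, exists n, 0 < nstep n i j.

(* For every state i, the gcd of the n >= 1 with P^n(i,i) > 0 is 1. *)
Definition aperiodic := forall (i : S) (g : nat),
  (forall n, (0 < n)%N -> 0 < nstep n i i -> (g %| n)%N) -> g = 1%N.

End transition_probabilities.

Section processes.
Context {d : measure_display} {Omega : measurableType d} {R : realType}.
Variable Pr : probability Omega R.
Context {S : countType}.
Implicit Types (Y : nat -> Omega -> S) (A B C : set S) (D : set (set S)).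

Definition trajectory Y (n : nat) (x : nat -> S) : set Omega :=
  [set w | forall k, (k <= n)%N -> Y k w = x k].

(* The Markov property is in product form, so that no conditioning on null
   events occurs; the law of Y 0 is unconstrained. *)
Definition markov_chain (P : S -> S -> R) Y :=
  (forall n i, measurable (Y n @^-1` [set i])) /\
  (forall n (x : nat -> S),
    Pr (trajectory Y n.+1 x) = Pr (trajectory Y n x) * (P (x n) (x n.+1))%:E).

Definition skeleton (m : nat) Y : nat -> Omega -> S := fun n => Y (n * m)%N.

Definition visits_io Y C : set Omega := lim_sup_set (fun n => Y n @^-1` C).

Definition stays_in Y C : set Omega :=
  \bigcup_n \bigcap_(k in [set k | (n <= k)%N]) (Y k @^-1` C).

Definition transient Y C := Pr (visits_io Y C) = 0.

Definition regular Y C := Pr (visits_io Y C `\` stays_in Y C) = 0.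

Definition almost_closed Y C := regular Y C /\ ~ transient Y C.

Definition atomic Y C := almost_closed Y C /\
  ~ (exists A B, [/\ almost_closed Y A, almost_closed Y B,
                     A `<=` C, B `<=` C & A `&` B = set0]).

(* Almost closed sets are nonempty, so a set D of pairwise disjoint ones loses
   nothing compared with an indexed collection.  A state i is transient when
   the set [set i] is. *)
Definition blackwell_decomposition Y D :=
  [/\ countable D /\ trivIset D id,
      (forall C, D C -> almost_closed Y C),
      (forall A B, D A -> D B -> ~ atomic Y A -> ~ atomic Y B -> A = B),
      (forall C, D C -> ~ atomic Y C ->
         (forall A, A `<=` C -> ~ atomic Y A) /\
         (forall i, C i -> transient Y [set i])) &
      \esum_(C in D) Pr (stays_in Y C) = 1].

(* A decomposition of a Markov chain exists and is unique up to equivalence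
   (Blackwell), so the choice made by xget is immaterial; the default set0 is
   never a decomposition. *)
Definition blackwell_number Y : \bar R :=
  counting (xget set0 [set D | blackwell_decomposition Y D]).

Definition simple Y := blackwell_number Y = 1.

Definition asymptotic_period Y : \bar R :=
  ereal_sup [set m%:R%:E | m in
    [set m : nat | (1 <= m)%N /\ blackwell_number (skeleton m Y) = m%:R%:E]].

Definition asymptotically_aperiodic Y := asymptotic_period Y = 1.

End processes.

(* Main.v *)
(* Write L_j for the event that X(km + j) lies in C for all large k.  If at a
   time divisible by m the chain is in a state i with P(i,i) >= delta, and the
   conditional probability of K = L_j \ L_(j+1) is q, then holding at i for one
   step turns K into L_(j+1) \ L_(j+2), an event disjoint from K; hence
   (1 + delta) q <= 1.  From the other states one first follows a path to such
   an i, so q is bounded away from 1 uniformly over all finite histories.  Since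
   K is a monotone limit of cylinder events, the bound P(K /\ B) <= r P(B) with
   r < 1 passes from finite histories B to B = K, and P(K) = 0.  Cycling through
   j = 0, ..., m, the m-step chain eventually stays in C almost surely only
   when X does.  The sets of a Blackwell decomposition for the m-step chain are
   therefore almost closed for X, and simplicity leaves room for only one. *)
Require Import Defs.
From mathcomp Require Import all_boot all_order all_algebra.
From mathcomp Require Import all_classical all_reals all_analysis.
From mathcomp Require Import lra.

Set Implicit Arguments.
Unset Strict Implicit.
Unset Printing Implicit Defensive.

Import Order.TTheory GRing.Theory Num.Theory.

Local Open Scope classical_set_scope.
Local Open Scope ring_scope.

(** * Comparing measures along countable partitions *)

Section countable_partition.
Context {d : measure_display} {Omega : measurableType d}.

Lemma measurable_preimage_count (T : countType) (f : Omega -> T) (B : set T) :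
  (forall t, measurable (f @^-1` [set t])) -> measurable (f @^-1` B).
Proof.
move=> mf.
have -> : f @^-1` B = \bigcup_t (if t \in B then f @^-1` [set t] else set0).
  apply/seteqP; split=> [w Bw|w [t _]].
    by exists (f w) => //; rewrite mem_set.
  by case: ifPn => // /set_mem Bt wt; rewrite /preimage /= wt.
apply: countable_bigcupT_measurable; first exact: countableP.
by move=> t; case: ifP.
Qed.

Context {R : realType}.

(** By countable additivity both sides are sums over fibres, compared term by term. [pickle] indexes
    the fibres by natural numbers; a number that codes no element gives the empty set. *)
Lemma le_measure_partition (T : countType) (mu nu : {measure set Omega -> \bar R})
    (f f' : Omega -> T) (B B' : set Omega) :
  (forall t, measurable (f @^-1` [set t])) ->
  (forall t, measurable (f' @^-1` [set t])) ->
  measurable B -> measurable B' ->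
  (forall t, (mu (B `&` f @^-1` [set t]) <= nu (B' `&` f' @^-1` [set t]))%E) ->
  (mu B <= nu B')%E.
Proof.
move=> mf mf' mB mB' le_t.
pose F (g : Omega -> T) (A : set Omega) k := A `&` g @^-1` [set t | pickle t = k].
have mF g A : (forall t, measurable (g @^-1` [set t])) -> measurable A ->
    forall k, measurable (F g A k).
  by move=> mg mA k; apply: measurableI => //; apply: measurable_preimage_count.
have bigF g A : \bigcup_k F g A k = A.
  apply/seteqP; split=> [w [k _ []]//|w Aw].
  by exists (pickle (g w)).
have trivF g A : trivIset setT (F g A).
  apply/trivIsetP => i j _ _ /eqP ij; apply/seteqP; split=> // w.
  by move=> [[_ /= wi] [_ /= wj]]; case: ij; rewrite -wi.
rewrite -(bigF f B) -(bigF f' B') !measure_semi_bigcup //; try exact: mF.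
- apply: lee_nneseries => // k _; rewrite /F.
  have [[t tk]|nt] := pselect (exists t : T, pickle t = k).
    have -> : [set t | pickle t = k] = [set t].
      apply/seteqP; split=> [u /= uk|_ ->] //.
      by apply: (pcan_inj (@pickleK T)); rewrite uk tk.
    exact: le_t.
  have -> : [set t : T | pickle t = k] = set0.
    by apply/seteqP; split=> // t tk; case: nt; exists t.
  by rewrite !preimage_set0 !setI0 !measure0.
- by rewrite bigF.
- by rewrite bigF.
Qed.

End countable_partition.

(** * Path events obtained as monotone limits of cylinders *)

Section cylinder_limits.
Context {S : countType}.
Implicit Types (E : set (nat -> S)) (x y : nat -> S).

Definition cylinder (n : nat) E := forall x y,
  (forall k, (k <= n)%N -> x k = y k) -> E x -> E y.

(** Only monotone limits are allowed: an inequality between finite measures passes through them by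
    continuity, but not through complements. *)
Inductive cylinder_limit : set (nat -> S) -> Prop :=
| cylinder_limit_cylinder n E : cylinder n E -> cylinder_limit E
| cylinder_limit_bigcup (F : nat -> set (nat -> S)) :
    nondecreasing_seq F -> (forall n, cylinder_limit (F n)) ->
    cylinder_limit (\bigcup_n F n)
| cylinder_limit_bigcap (F : nat -> set (nat -> S)) :
    nonincreasing_seq F -> (forall n, cylinder_limit (F n)) ->
    cylinder_limit (\bigcap_n F n).

Context {d : measure_display} {Omega : measurableType d}.
Implicit Types Z : nat -> Omega -> S.

Definition path_event Z E : set Omega := [set w | E (Z ^~ w)].

Definition measurable_process Z :=
  forall n i, measurable (Z n @^-1` [set i]).

(** Coding a history as a list gives it a countable type, so that histories form a countable
    partition. *)
Let prefix Z n w := mkseq (Z ^~ w) n.+1.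

Let prefixE Z n w : prefix Z n @^-1` [set prefix Z n w] = trajectory Z n (Z ^~ w).
Proof.
apply/seteqP; split=> v /=.
  move=> e k kn; have := congr1 (nth (Z 0%N w) ^~ k) e.
  by rewrite /prefix !nth_mkseq.
move=> e; apply: (@eq_from_nth _ (Z 0%N w)); rewrite !size_mkseq// => k kn.
by rewrite !nth_mkseq// e.
Qed.

Lemma measurable_trajectory Z n x : measurable_process Z ->
  measurable (trajectory Z n x).
Proof.
move=> mZ.
have -> : trajectory Z n x =
    \bigcap_(k in [set k | (k <= n)%N]) (Z k @^-1` [set x k]).
  by apply/seteqP; split.
by apply: bigcap_measurableType => k _; apply: mZ.
Qed.

Let measurable_prefix Z n t : measurable_process Z ->
  measurable (prefix Z n @^-1` [set t]).
Proof.
move=> mZ; have [[w <-]|nw] := pselect (exists w, prefix Z n w = t).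
  by rewrite prefixE; exact: measurable_trajectory.
rewrite (_ : _ @^-1` _ = set0)//.
by apply/seteqP; split=> // w wt; case: nw; exists w.
Qed.

Let path_event_bigcup Z (F : nat -> set (nat -> S)) :
  path_event Z (\bigcup_n F n) = \bigcup_n path_event Z (F n).
Proof. by []. Qed.

Let path_event_bigcap Z (F : nat -> set (nat -> S)) :
  path_event Z (\bigcap_n F n) = \bigcap_n path_event Z (F n).
Proof. by []. Qed.

Let path_event_nondecreasing Z (F : nat -> set (nat -> S)) :
  nondecreasing_seq F -> nondecreasing_seq (fun n => path_event Z (F n)).
Proof.
move=> ndF n k nk; apply/subsetPset => w.
by have /subsetPset := ndF n k nk; apply.
Qed.

Let path_event_nonincreasing Z (F : nat -> set (nat -> S)) :
  nonincreasing_seq F -> nonincreasing_seq (fun n => path_event Z (F n)).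
Proof.
move=> niF n k nk; apply/subsetPset => w.
by have /subsetPset := niF n k nk; apply.
Qed.

Lemma measurable_path_event Z E : measurable_process Z -> cylinder_limit E ->
  measurable (path_event Z E).
Proof.
move=> mZ; elim=> {E} [n E cE|F _ _ mF|F _ _ mF].
- rewrite (_ : path_event Z E =
    prefix Z n @^-1` [set t | exists2 w, prefix Z n w = t & E (Z ^~ w)]).
    by apply: measurable_preimage_count => t; apply: measurable_prefix.
  apply/seteqP; split=> [w Ew|w [v]]; first by exists w.
  move=> /esym vw Ev; have : trajectory Z n (Z ^~ v) w by rewrite -prefixE.
  by move=> wv; apply: cE Ev => k kn; rewrite wv.
- by rewrite path_event_bigcup; exact: bigcupT_measurable.
- by rewrite path_event_bigcap; exact: bigcapT_measurable.
Qed.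

Context {R : realType}.

(** Induction on the limit: a cylinder is a countable union of trajectories, and continuity of
    measures handles the monotone limits. Times divisible by [m] suffice, since a cylinder of depth
    [n] also has depth [n * m]. *)
Lemma le_measure_path_event (mu nu : {measure set Omega -> \bar R}) Z Z' m E :
  measurable_process Z -> measurable_process Z' -> (0 < m)%N ->
  (mu setT < +oo)%E -> (nu setT < +oo)%E ->
  (forall n x, (mu (trajectory Z (n * m) x) <= nu (trajectory Z' (n * m) x))%E) ->
  cylinder_limit E -> (mu (path_event Z E) <= nu (path_event Z' E))%E.
Proof.
move=> mZ mZ' m0 muT nuT le_traj.
elim=> {E} [n E cE|F ndF cF leF|F niF cF leF].
- have mE Y : measurable_process Y -> measurable (path_event Y E).
    by move=> mY; apply: measurable_path_event => //;
       exact: cylinder_limit_cylinder cE.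
  apply: (@le_measure_partition _ _ _ _ mu nu (prefix Z (n * m)) (prefix Z' (n * m))).
  + by move=> t; apply: measurable_prefix.
  + by move=> t; apply: measurable_prefix.
  + exact: mE.
  + exact: mE.
  move=> t.
  have [[w [Ew wt]]|nw] :=
      pselect (exists w, E (Z ^~ w) /\ prefix Z (n * m) w = t).
    have cyl Y : prefix Y (n * m) @^-1` [set t] = trajectory Y (n * m) (Z ^~ w).
      rewrite -wt; apply/seteqP; split=> v /=.
        move=> e k kn; have := congr1 (nth (Z 0%N w) ^~ k) e.
        by rewrite /prefix !nth_mkseq.
      move=> e; apply: (@eq_from_nth _ (Z 0%N w)); rewrite !size_mkseq// => k kn.
      by rewrite !nth_mkseq// e.
    have sub Y : path_event Y E `&` prefix Y (n * m) @^-1` [set t] =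
        trajectory Y (n * m) (Z ^~ w).
      rewrite cyl setIidr// => v wv; apply: cE Ew => k kn; rewrite wv//.
      by rewrite (leq_trans kn)// leq_pmulr.
    by rewrite !sub.
  rewrite (_ : path_event Z E `&` _ = set0) ?measure0//.
  by apply/seteqP; split=> // w [Ew wt]; case: nw; exists w.
- have cvgF mu' Y : measurable_process Y ->
      (mu' : {measure set Omega -> \bar R}) \o (fun n => path_event Y (F n)) @ \oo
        --> mu' (path_event Y (\bigcup_n F n)).
    move=> mY; rewrite path_event_bigcup; apply: nondecreasing_cvg_mu.
    + by move=> n; exact: measurable_path_event.
    + by apply: bigcupT_measurable => n; exact: measurable_path_event.
    + exact: path_event_nondecreasing.
  apply: (lee_cvg_to (cvgF mu _ mZ) (cvgF nu _ mZ')).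
  by apply: nearW => n; exact: leF.
- have cvgF mu' Y : measurable_process Y ->
      ((mu' : {measure set Omega -> \bar R}) setT < +oo)%E ->
      mu' \o (fun n => path_event Y (F n)) @ \oo
        --> mu' (path_event Y (\bigcap_n F n)).
    move=> mY mu'T; rewrite path_event_bigcap; apply: nonincreasing_cvg_mu.
    (* Continuity from above requires finite mass. *)
    + apply: le_lt_trans mu'T; apply: le_measure; rewrite ?inE//.
      exact: measurable_path_event.
    + by move=> n; exact: measurable_path_event.
    + by apply: bigcapT_measurable => n; exact: measurable_path_event.
    + exact: path_event_nonincreasing.
  apply: (lee_cvg_to (cvgF mu _ mZ muT) (cvgF nu _ mZ' nuT)).
  by apply: nearW => n; exact: leF.
Qed.

End cylinder_limits.

(** * Settling in a set along an arithmetic progression of times *)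

Section settling.
Context {S : countType}.
Implicit Types (C : set S) (y : nat -> S).

(** The event [L_j]. The index [j] is not reduced modulo [m], so going from [j] to [j.+1] needs no
    wrap-around. *)
Definition settle (m : nat) C (j : nat) : set (nat -> S) :=
  [set y | exists n, forall k, (n <= k)%N -> C (y (k * m + j)%N)].

(** The [n] whole blocks are absorbed by the threshold on [k]; only the remainder [r] moves the
    index. *)
Lemma settle_shift m C n r j y :
  settle m C j (fun k => y (n * m + r + k)%N) <-> settle m C (j + r) y.
Proof.
have idx k : (n * m + r + (k * m + j) = (n + k) * m + (j + r))%N.
  by rewrite mulnDl -!addnA; congr addn; rewrite addnCA; congr addn; exact: addnC.
split=> -[l Cl].
  exists (n + l)%N => k lk; have nk := leq_trans (leq_addr l n) lk.
  by rewrite -(subnKC nk) -idx; apply: Cl; rewrite leq_subRL.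
by exists l => k lk; rewrite idx; apply: Cl; rewrite (leq_trans lk)// leq_addl.
Qed.

(** [G n M] asks for [C] at offset [j] in blocks [n] to [M], and [H M q] for a failure at offset
    [j.+1] in some block from [M] to [q]. Sharing [M] merges both universal quantifiers into one
    decreasing intersection. *)
Lemma cylinder_limit_settleD m C j :
  cylinder_limit (settle m C j `\` settle m C j.+1).
Proof.
pose G n M : set (nat -> S) :=
  [set y | forall k, (n <= k <= M)%N -> C (y (k * m + j)%N)].
pose H M q : set (nat -> S) :=
  [set y | exists2 k, (M <= k <= q)%N & ~ C (y (k * m + j.+1)%N)].
have -> : settle m C j `\` settle m C j.+1 =
    \bigcup_n \bigcap_M \bigcup_q (G n M `&` H M q).
  apply/seteqP; split=> y /=.
    move=> [[n Cn] nC]; exists n => // M _.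
    have [k Mk nCk] : exists2 k, (M <= k)%N & ~ C (y (k * m + j.+1)%N).
      apply: contrapT => nk; apply: nC; exists M => k Mk.
      by apply: contrapT => nCk; apply: nk; exists k.
    exists k => //; split; last by exists k; rewrite ?Mk /=.
    by move=> l /andP[nl _]; exact: Cn.
  move=> [n _ GH]; split.
    exists n => k nk; have [q _ [Gk _]] := GH k I.
    by apply: Gk; rewrite nk /=.
  by move=> [M CM]; have [q _ [_ [k /andP[Mk _]]]] := GH M I; apply; exact: CM.
apply: cylinder_limit_bigcup => [n n' nn'|n].
  apply/subsetPset => y GH M _; have [q _ [Gy Hy]] := GH M I.
  exists q => //; split=> // k /andP[nk kM]; apply: Gy.
  by rewrite kM (leq_trans nn').
apply: cylinder_limit_bigcap => [M M' MM'|M].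
  apply/subsetPset => y [q _ [Gy [k /andP[Mk kq] nCk]]]; exists q => //; split.
    by move=> l /andP[nl lM]; apply: Gy; rewrite nl (leq_trans lM).
  by exists k; rewrite ?kq ?andbT ?(leq_trans MM').
apply: cylinder_limit_bigcup => [q q' qq'|q].
  apply/subsetPset => y [Gy [k /andP[Mk kq] nCk]]; split=> //.
  by exists k; rewrite ?Mk ?(leq_trans kq).
(* This depth covers the last times inspected, [M * m + j] by [G n M] and [q * m + j.+1] by
   [H M q]. *)
apply: (@cylinder_limit_cylinder _ ((M + q) * m + j.+1)%N) => y y' yy' [Gy Hy].
split=> [k nkM|].
  rewrite -yy'; first exact: Gy.
  rewrite leq_add// leq_mul// (leq_trans _ (leq_addr _ _))//.
  by case/andP: nkM.
have [k Mkq nCk] := Hy; exists k => //; rewrite -yy'//.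
rewrite leq_add2r leq_mul// (leq_trans _ (leq_addl _ _))//.
by case/andP: Mkq.
Qed.

End settling.

(** * Eventual stay and infinitely many visits *)

Section limit_events.
Context {d : measure_display} {Omega : measurableType d} {S : countType}.
Implicit Types (Y : nat -> Omega -> S) (A C : set S).

Lemma measurable_stays_in Y C : measurable_process Y -> measurable (stays_in Y C).
Proof.
move=> mY; apply: bigcupT_measurable => n; apply: bigcap_measurableType => k _.
by apply: measurable_preimage_count; exact: mY.
Qed.

Lemma measurable_visits_io Y C : measurable_process Y -> measurable (visits_io Y C).
Proof.
move=> mY; apply: bigcapT_measurable => n; apply: bigcup_measurable => k _.
by apply: measurable_preimage_count; exact: mY.
Qed.

Lemma stays_in_visits_io Y C : stays_in Y C `<=` visits_io Y C.
Proof.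
move=> w [n _ Cn] k _; exists (maxn n k); first exact: leq_maxr.
by apply: Cn; exact: leq_maxl.
Qed.

Lemma stays_inS Y A C : A `<=` C -> stays_in Y A `<=` stays_in Y C.
Proof. by move=> sAC w [n _ An]; exists n => // k nk; apply: sAC; exact: An. Qed.

Lemma visits_ioS Y A C : A `<=` C -> visits_io Y A `<=` visits_io Y C.
Proof. by move=> sAC w Aw n _; have [k nk Ak] := Aw n I; exists k => //; exact: sAC. Qed.

Lemma stays_inI Y A C : stays_in Y (A `&` C) = stays_in Y A `&` stays_in Y C.
Proof.
apply/seteqP; split=> w.
  by move=> ACw; split; apply: stays_inS ACw => i [].
move=> [[n _ An] [k _ Ck]]; exists (maxn n k) => // l; rewrite /= geq_max => /andP[nl kl].
by split; [exact: An | exact: Ck].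
Qed.

Lemma stays_in_visits_ioI Y A C :
  stays_in Y A `&` visits_io Y C `<=` visits_io Y (A `&` C).
Proof.
move=> w [[n _ An] Cw] k _; have [l /= kl Cl] := Cw (maxn n k) I.
move: kl; rewrite geq_max => /andP[nl kl]; exists l => //; split=> //.
exact: An.
Qed.

Lemma visits_io0 Y : visits_io Y set0 = set0.
Proof. by apply/seteqP; split=> // w Vw; have [] := Vw 0%N I. Qed.

Lemma stays_in_skeletonS m Y C : (0 < m)%N ->
  stays_in Y C `<=` stays_in (skeleton m Y) C.
Proof.
move=> m0 w [n _ Cn]; exists n => // k /= nk; apply: Cn => /=.
by rewrite (leq_trans nk)// leq_pmulr.
Qed.

Lemma visits_io_skeletonS m Y C : (0 < m)%N ->
  visits_io (skeleton m Y) C `<=` visits_io Y C.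
Proof.
move=> m0 w Cw n _; have [k /= nk Ck] := Cw n I; exists (k * m)%N => //=.
by rewrite (leq_trans nk)// leq_pmulr.
Qed.

End limit_events.

(** * The Markov property and paths of positive probability *)

Section markov_property.
Context {d : measure_display} {Omega : measurableType d} {R : realType}.
Context {S : countType}.
Variables (Pr : probability Omega R) (P : S -> S -> R) (X : nat -> Omega -> S).
Hypotheses (hP : forall i j, (0 <= P i j)%R) (hX : markov_chain Pr P X).
Implicit Types (x y : nat -> S) (A : set Omega) (C : set S).

Let mX : measurable_process X. Proof. by case: hX. Qed.

Let shift N : nat -> Omega -> S := fun k => X (N + k)%N.

Let mshift N : measurable_process (shift N).
Proof. by move=> n i; exact: mX. Qed.

Let mtraj N x : measurable (trajectory X N x).
Proof. exact: measurable_trajectory. Qed.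

Let fineE A : measurable A -> exists2 a : R, 0 <= a & Pr A = a%:E.
Proof.
move=> mA; exists (fine (Pr A)); first exact/fine_ge0.
by rewrite fineK// fin_num_measure.
Qed.

Let splice N x y k := if (k <= N)%N then x k else y (k - N)%N.

Let spliceE N x y n : y 0%N = x N -> splice N x y (N + n) = y n.
Proof.
move=> y0; rewrite /splice; case: leqP; last by rewrite addKn.
by rewrite -[leqRHS]addn0 leq_add2l leqn0 => /eqP ->; rewrite addn0.
Qed.

Let trajectory_splice0 N x y : trajectory X N (splice N x y) = trajectory X N x.
Proof.
by apply/seteqP; split=> w xw k kN; have := xw k kN; rewrite /splice kN.
Qed.

Let trajectory_splice N x y n : y 0%N = x N ->
  trajectory (shift N) n y `&` trajectory X N x =
  trajectory X (N + n) (splice N x y).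
Proof.
move=> y0; apply/seteqP; split=> w.
  move=> [yw xw] k kNn; rewrite /splice; case: leqP => [|/ltnW Nk].
    exact: xw.
  by rewrite -{1}(subnKC Nk); apply: yw; rewrite leq_subLR.
move=> sw; split=> [k kn|].
  by rewrite /shift sw ?leq_add2l// spliceE.
rewrite -(trajectory_splice0 N x y) => k kN; apply: sw.
by rewrite (leq_trans kN)// leq_addr.
Qed.

(** Two histories ending in the same state are prolonged with the same transition factors, so the
    ratio [c] persists on trajectories, and then on limits by two inequalities. The factor [c]
    avoids conditioning on null events. *)
Lemma markov_future N N' x x' (c : R) E : 0 <= c -> x N = x' N' ->
  Pr (trajectory X N' x') = (c%:E * Pr (trajectory X N x))%E ->
  cylinder_limit E ->
  Pr (path_event (shift N') E `&` trajectory X N' x') =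
  (c%:E * Pr (path_event (shift N) E `&` trajectory X N x))%E.
Proof.
move=> c0 xx' cx cE.
have step n y : Pr (trajectory (shift N') n y `&` trajectory X N' x') =
    (c%:E * Pr (trajectory (shift N) n y `&` trajectory X N x))%E.
  (* A future [y] that does not start in the last state of the history gives empty events on both
     sides. *)
  have [y0|y0] := pselect (y 0%N = x N); last first.
    have e0 M z : z M = x N -> trajectory (shift M) n y `&` trajectory X M z = set0.
      move=> zx; apply/seteqP; split=> // w [yw zw]; apply: y0.
      by rewrite -zx -(yw 0%N)// /shift addn0 zw.
    by rewrite !e0// !measure0 mule0.
  rewrite !trajectory_splice -?xx'//.
  elim: n => [|n IHn]; first by rewrite !addn0 !trajectory_splice0.
  by rewrite !addnS !(proj2 hX) IHn -!addnS !spliceE -?xx'// muleA.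
pose mu : {measure set Omega -> \bar R} := mrestr Pr (mtraj N' x').
pose nu : {measure set Omega -> \bar R} :=
  mscale (NngNum c0) (mrestr Pr (mtraj N x)).
have muT : (mu setT < +oo)%E.
  by rewrite /mu/= /mrestr setTI; have [a _ ->] := fineE (mtraj N' x'); rewrite ltry.
have nuT : (nu setT < +oo)%E.
  rewrite /nu/= /mscale/= /mrestr/= setTI.
  by have [a _ ->] := fineE (mtraj N x); rewrite -EFinM ltry.
apply/eqP; rewrite eq_le; apply/andP; split.
  apply: (@le_measure_path_event _ _ _ _ mu nu _ _ 1) => // n y.
  by rewrite muln1 /mu /nu/= /mscale/= /mrestr step.
apply: (@le_measure_path_event _ _ _ _ nu mu _ _ 1) => // n y.
by rewrite muln1 /mu /nu/= /mscale/= /mrestr step.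
Qed.

(* A single trajectory witnesses that [j] is reachable, with a probability that
   does not depend on the history leading to [i]. *)
Definition reaches l i j := exists2 p : R, 0 < p & forall N x, x N = i ->
  exists x', [/\ x' (N + l)%N = j, trajectory X (N + l) x' `<=` trajectory X N x &
    Pr (trajectory X (N + l) x') = (p%:E * Pr (trajectory X N x))%E].

Lemma reaches_refl i : reaches 0 i i.
Proof.
by exists 1 => [|N x xi]; [exact: ltr01 | exists x; rewrite addn0 mul1e; split].
Qed.

Lemma reaches_trans l l' i j k : reaches l i j -> reaches l' j k ->
  reaches (l + l') i k.
Proof.
move=> [p p0 hp] [q q0 hq]; exists (q * p); first exact: mulr_gt0.
move=> N x xi; have [y [yj yx Pry]] := hp N x xi.
have [z [zk zy Prz]] := hq _ y yj; exists z; rewrite addnA.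
by split=> //; [exact: subset_trans yx | rewrite Prz Pry muleA EFinM].
Qed.

Lemma reaches_step i j : 0 < P i j -> reaches 1 i j.
Proof.
move=> Pij; exists (P i j) => // N x xi.
exists (fun k => if (k <= N)%N then x k else j); rewrite addn1.
have E : trajectory X N (fun k => if (k <= N)%N then x k else j) = trajectory X N x.
  by apply/seteqP; split=> w xw k kN; have := xw k kN; rewrite kN.
split; first by rewrite ltnn.
  by rewrite -E => w xw k kN; apply: xw; exact: leqW.
by rewrite (proj2 hX) E leqnn ltnn xi muleC.
Qed.

Lemma nstep_ge0 n i j : (0 <= nstep P n i j)%E.
Proof.
elim: n i => [|n IHn] i /=; first by case: ifP.
by apply: esum_ge0 => k _; rewrite mule_ge0// lee_fin.
Qed.

Lemma nstep_reaches n i j : (0 < nstep P n i j)%E -> reaches n i j.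
Proof.
elim: n i => [|n IHn] i /=.
  by case: eqP => [->|_]; rewrite ?ltxx// => _; exact: reaches_refl.
move=> gt0; have [k] : exists k, ((P i k)%:E * nstep P n k j)%E != 0%E.
  apply: contrapT => nk; move: gt0; rewrite esum1 ?ltxx// => k _.
  by apply/eqP; apply: contrapT => /negP ne0; apply: nk; exists k.
rewrite mule_eq0 negb_or eqe => /andP[Pik nkj].
rewrite -add1n; apply: (@reaches_trans _ _ _ k).
  by apply: reaches_step; rewrite lt_neqAle eq_sym Pik hP.
by apply: IHn; rewrite lt_neqAle eq_sym nkj nstep_ge0.
Qed.

(** Holding at [j] pads the path; this brings its length to a multiple of [m]. *)
Lemma reaches_loop l l' i j : reaches l i j -> 0 < P j j -> (l <= l')%N ->
  reaches l' i j.
Proof.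
move=> rij Pjj /subnKC <-; elim: (l' - l)%N => [|n IHn]; first by rewrite addn0.
by rewrite addnS -addn1; exact: reaches_trans IHn (reaches_step Pjj).
Qed.

(** * Uniform bounds on conditional probabilities *)

Section conditional_bound.
Variable m : nat.

(* The conditional probability of [A], given a history whose length is a
   multiple of [m] and which ends in [i], is at most [r]. *)
Definition bounded_at A (i : S) (r : R) := forall n x, x (n * m)%N = i ->
  (Pr (A `&` trajectory X (n * m) x) <= r%:E * Pr (trajectory X (n * m) x))%E.

Lemma bounded_atW A i r r' : r <= r' -> bounded_at A i r -> bounded_at A i r'.
Proof.
move=> rr' bi n x xi; apply: le_trans (bi n x xi) _.
by rewrite lee_wpmul2r// lee_fin.
Qed.

(** With conditional probability [p] the path to [j] is followed, and then [A] has probability at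
    most [r]; otherwise at most 1. Altogether [p * r + (1 - p) = 1 - p * (1 - r)]. *)
Lemma reaches_bounded_at A l i j r : measurable A -> reaches (l * m) i j ->
  r < 1 -> bounded_at A j r -> exists2 r', r' < 1 & bounded_at A i r'.
Proof.
move=> mA [p p0 hp] r1 bj; exists (1 - p * (1 - r)).
  by rewrite ltrBlDr ltrDl mulr_gt0// subr_gt0.
move=> n x xi; have [y []] := hp _ x xi; rewrite -mulnDl => yj yx Pry.
set B := trajectory X (n * m) x in yx Pry *.
have {bj} := bj _ _ yj; set B' := trajectory X _ y in yx Pry *.
have mB : measurable B by exact: mtraj.
have mB' : measurable B' by exact: mtraj.
have [a a0 aE] := fineE mB; have [b b0 bE] := fineE (measurableI _ _ mA mB').
rewrite Pry aE bE -!EFinM lee_fin => ba.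
have le_split : (Pr (A `&` B) <= Pr (A `&` B') + Pr (B `\` B'))%E.
  apply: (@le_trans _ _ (Pr ((A `&` B') `|` (B `\` B')))).
    apply: le_measure; rewrite ?inE; [exact: measurableI| |].
      by apply: measurableU; [exact: measurableI | exact: measurableD].
    by move=> w [Aw Bw]; have [B'w|] := pselect (B' w); [left|right].
  by apply: measureU2; [exact: measurableI | exact: measurableD].
apply: (le_trans le_split).
have Boo : (Pr B < +oo)%E by rewrite aE ltry.
have -> : (Pr (B `\` B') = Pr B - Pr B')%E.
  by rewrite (measureD mB mB' Boo) (setIidr yx).
rewrite Pry aE bE -EFinM -EFinB -EFinD lee_fin.
nra.
Qed.

(* The bound extends from histories to all limits of cylinder events, in
   particular to the event itself. *)
Lemma bounded_at_null E (r : R) : (0 < m)%N -> r < 1 -> cylinder_limit E ->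
  (forall i, bounded_at (path_event X E) i r) -> Pr (path_event X E) = 0.
Proof.
move=> m0 r1 cE bE; have mE : measurable (path_event X E).
  exact: measurable_path_event.
(* Scaling a measure needs a nonnegative factor; [Num.max r 0] is still below 1. *)
wlog r0 : r r1 bE / 0 <= r.
  move=> /(_ (Num.max r 0)); apply; rewrite ?gt_max ?r1 ?ltr01 ?le_max ?lexx ?orbT//.
  by move=> i; apply: bounded_atW (bE i); rewrite le_max lexx.
pose mu : {measure set Omega -> \bar R} := mrestr Pr mE.
pose nu : {measure set Omega -> \bar R} := mscale (NngNum r0) Pr.
have [a a0 aE] := fineE mE.
have : (mu (path_event X E) <= nu (path_event X E))%E.
  apply: (@le_measure_path_event _ _ _ _ mu nu _ _ m) => //.
  - by rewrite /mu/= /mrestr setTI aE ltry.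
  - by rewrite /nu/= /mscale/= probability_setT mule1 ltry.
  - move=> n x; rewrite /mu /nu/= /mrestr /mscale/= setIC.
    exact: bE.
rewrite /mu /nu/= /mrestr /mscale/= setIid aE -EFinM lee_fin => ara.
by congr EFin; apply/eqP; rewrite eq_le a0 andbT; nra.
Qed.

(** Holding at [i] costs a factor [P i i] and leaves the conditional law of the future unchanged.
    The two disjoint events inside the history then give [b + P i i * b <= a]. *)
Lemma lazy_bounded_at C j (delta : R) i : 0 < delta -> delta <= P i i ->
  bounded_at (path_event X (settle m C j `\` settle m C j.+1)) i (1 + delta)^-1.
Proof.
move=> d0 dP n x xi; set E := _ `\` _; set N := (n * m)%N.
have cE : cylinder_limit E by exact: cylinder_limit_settleD.
(* [x'] prolongs the history by one step of holding at [i]. *)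
pose x' k := if (k <= N)%N then x k else x N.
have x'N1 : x' N.+1 = x N by rewrite /x' ltnn.
have trajE : trajectory X N x' = trajectory X N x.
  by apply/seteqP; split=> w xw k kN; have := xw k kN; rewrite /x' kN.
have Prx' : Pr (trajectory X N.+1 x') = ((P i i)%:E * Pr (trajectory X N x))%E.
  by rewrite (proj2 hX) trajE x'N1 /x' leqnn xi muleC.
have := markov_future (hP i i) (esym x'N1) Prx' cE.
have settleN r j' w :
    settle m C j' ((shift (N + r)) ^~ w) <-> settle m C (j' + r) (X ^~ w).
  exact: (settle_shift m C n r j' (X ^~ w)).
have -> : path_event (shift N) E = path_event X E.
  have settle0 j' w : settle m C j' ((shift N) ^~ w) <-> settle m C j' (X ^~ w).
    by have := settleN 0%N j' w; rewrite !addn0.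
  by apply/seteqP; split=> w [/settle0 sj nsj]; split=> // /settle0.
set A := trajectory X N x; set A' := trajectory X N.+1 x'.
set K := path_event X E; set K' := path_event (shift N.+1) E => PrK'.
have mA : measurable A by exact: mtraj.
have mK : measurable (K `&` A).
  by apply: measurableI => //; exact: measurable_path_event.
have mK' : measurable (K' `&` A').
  by apply: measurableI; [exact: measurable_path_event | exact: mtraj].
(* Seen from time [N.+1], index [j] becomes [j.+1]: [K'] lies in [L_(j+1)], which [K] excludes. *)
have disjKK' : [disjoint K `&` A & K' `&` A'].
  apply/disj_set2P/seteqP; split=> // w [[[_ nsj] _] [[sj _] _]].
  by apply: nsj; move: sj; rewrite -addn1 settleN addn1.
have : (Pr ((K `&` A) `|` (K' `&` A')) <= Pr A)%E.
  apply: le_measure; rewrite ?inE//; first exact: measurableU.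
  move=> w [[]//|[_ x'w]]; rewrite /A -trajE => k kN.
  by apply: x'w; exact: leqW.
have -> : (Pr ((K `&` A) `|` (K' `&` A')) = Pr (K `&` A) + Pr (K' `&` A'))%E.
  by rewrite measureU//; exact/disj_set2P.
have [a a0 aE] := fineE mA; have [b b0 bE] := fineE mK.
rewrite PrK' aE bE -!EFinM -EFinD !lee_fin => ab.
rewrite ler_pdivlMl ?addr_gt0//; nra.
Qed.

End conditional_bound.

Lemma stays_in_skeleton m C (delta : R) : (0 < m)%N ->
  infinite_set [set: S] -> irreducible P ->
  0 < delta -> finite_set [set i | ~ (delta <= P i i)] ->
  Pr (stays_in (skeleton m X) C `\` stays_in X C) = 0.
Proof.
move=> m0 infS irr d0 finF.
have null j : Pr (path_event X (settle m C j `\` settle m C j.+1)) = 0.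
  set K := path_event X _.
  have mK : measurable K.
    by apply: measurable_path_event => //; exact: cylinder_limit_settleD.
  have rlt1 : (1 + delta)^-1 < 1 by rewrite invf_lt1 ?ltrDl// addr_gt0.
  (* The state space is infinite and the exceptional set finite, so a lazy state exists. *)
  have [j0 dj0] : exists j0, delta <= P j0 j0.
    apply: contrapT => nj0; apply: infS; apply: sub_finite_set finF.
    by move=> i _ di; apply: nj0; exists i.
  have loc i : exists2 r, r < 1 & bounded_at m K i r.
    have [l /nstep_reaches rl] := irr i j0.
    have rlm : reaches (l * m) i j0.
      by apply: reaches_loop rl _ _; [exact: lt_le_trans dj0 | rewrite leq_pmulr].
    exact: (reaches_bounded_at mK rlm rlt1 (lazy_bounded_at _ _ d0 dj0)).
  have /finite_seqP[s sE] := finF.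
  (* A common bound: the maximum of the lazy bound and of the local bounds at the finitely many
     exceptional states. *)
  have [r r1 [r0 rs]] : exists2 r, r < 1 &
      (1 + delta)^-1 <= r /\ forall i, i \in s -> bounded_at m K i r.
    elim: s {sE} => [|i s [r r1 [r0 rs]]]; first by exists (1 + delta)^-1.
    have [r' r'1 r'i] := loc i.
    exists (Num.max r r'); rewrite ?gt_max ?r1// le_max r0; split=> // k.
    rewrite inE => /orP[/eqP ->|ks].
      by apply: bounded_atW r'i; rewrite le_max lexx orbT.
    by apply: bounded_atW (rs k ks); rewrite le_max lexx.
  apply: (@bounded_at_null m _ r) => // [|i]; first exact: cylinder_limit_settleD.
  have [/rs//|ns] := boolP (i \in s).
  apply: (bounded_atW r0); apply: lazy_bounded_at => //.
  by apply: contrapT => di; move/negP: ns; apply; have : [set` s] i by rewrite -sE.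
apply: (@measure_negligible _ _ _ Pr); last first.
  apply: (@negligibleS _ _ _ _
    (\bigcup_j path_event X (settle m C j `\` settle m C j.+1))).
    move=> w [[n _ Cn] nC]; apply: contrapT => nU; apply: nC.
    (* Off the null events [L_j] implies [L_(j+1)], starting from [L_0], the eventual stay of the
       skeleton. *)
    have sw j : settle m C j (X ^~ w).
      elim: j => [|j IHj]; first by exists n => k nk; rewrite addn0; exact: Cn.
      by apply: contrapT => nj; apply: nU; exists j.
    have [l hl] := choice sw.
    (* Beyond this time the block number [k %/ m] exceeds the threshold of every residue. *)
    exists ((\max_(j < m) l j) * m)%N => // k /= lk.
    rewrite /preimage /= (divn_eq k m); apply: hl.
    have kr : (k %% m < m)%N by rewrite ltn_mod.
    by rewrite leq_divRL// (leq_trans _ lk)// leq_mul// (leq_bigmax (Ordinal kr)).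
  apply: negligible_bigcup => j; apply/negligibleP; last exact: null.
  by apply: measurable_path_event => //; exact: cylinder_limit_settleD.
by apply: measurableD; apply: measurable_stays_in => // n i; exact: mX.
Qed.

End markov_property.

(** * Almost closed sets of a chain and of its skeleton *)

Section almost_closed_sets.
Context {d : measure_display} {Omega : measurableType d} {R : realType}.
Context {S : countType} (Pr : probability Omega R).
Implicit Types (Y : nat -> Omega -> S) (A B C : set S) (D : set (set S)).

Lemma probability1_setC (A : set Omega) : measurable A -> Pr A = 1%E ->
  Pr (~` A) = 0.
Proof. by move=> mA A1; rewrite probability_setC// A1 subee. Qed.

(** On the almost sure event of staying in [A], visiting or staying in [C] is the same as visiting
    or staying in the intersection. *)
Lemma almost_closedI Y A C : measurable_process Y -> Pr (stays_in Y A) = 1%E ->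
  almost_closed Pr Y C -> almost_closed Pr Y (A `&` C).
Proof.
move=> mY A1 [rC ntC].
have mV B : measurable (visits_io Y B) by exact: measurable_visits_io.
have mL B : measurable (stays_in Y B) by exact: measurable_stays_in.
have nA : Pr.-negligible (~` stays_in Y A).
  by apply/negligibleP; [exact: measurableC | exact: probability1_setC].
split.
  apply: (@measure_negligible _ _ _ Pr); first exact: measurableD.
  apply: (@negligibleS _ _ _ _ (~` stays_in Y A `|` (visits_io Y C `\` stays_in Y C))).
    move=> w [ACw nACw]; have [Aw|] := pselect (stays_in Y A w); [right|by left].
    split; first by apply: visits_ioS ACw => i [].
    by move=> Cw; apply: nACw; rewrite stays_inI.
  by apply: negligibleU => //; apply/negligibleP => //; exact: measurableD.
move=> tAC; apply: ntC; apply: (@measure_negligible _ _ _ Pr) => //.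
apply: (@negligibleS _ _ _ _ (~` stays_in Y A `|` visits_io Y (A `&` C))).
  move=> w Cw; have [Aw|] := pselect (stays_in Y A w); [right|by left].
  exact: stays_in_visits_ioI.
by apply: negligibleU => //; apply/negligibleP.
Qed.

(** The skeleton visits less and stays more easily, whence regularity. For nontransience, infinitely
    many visits of [Y] almost surely mean staying, which the skeleton inherits. *)
Lemma almost_closed_skeleton m Y A : measurable_process Y -> (0 < m)%N ->
  almost_closed Pr Y A -> almost_closed Pr (skeleton m Y) A.
Proof.
move=> mY m0 [rA ntA].
have mYm : measurable_process (skeleton m Y) by move=> n i; exact: mY.
have mR Z B : measurable_process Z -> measurable (visits_io Z B `\` stays_in Z B).
  by move=> mZ; apply: measurableD;
    [exact: measurable_visits_io | exact: measurable_stays_in].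
split.
  apply: (subset_measure0 _ _ _ rA); [exact: mR..|].
  move=> w [Vw nLw]; split; first exact: visits_io_skeletonS Vw.
  by move=> Lw; apply: nLw; exact: stays_in_skeletonS.
move=> tA; apply: ntA; apply: (@measure_negligible _ _ _ Pr).
  exact: measurable_visits_io.
apply: (@negligibleS _ _ _ _
    (visits_io (skeleton m Y) A `|` (visits_io Y A `\` stays_in Y A))).
  move=> w Vw; have [Lw|] := pselect (stays_in Y A w); [left|by right].
  by apply: stays_in_visits_io; exact: stays_in_skeletonS.
by apply: negligibleU; apply/negligibleP => //; [exact: measurable_visits_io | exact: mR].
Qed.

(** By [null] the events [stays_in Y A], for [A] in [D], have total probability 1. So [Y] almost
    surely settles in one member of [D], and visits every other one only finitely often. *)
Lemma blackwell_decomposition_skeleton m Y D C : measurable_process Y ->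
  (0 < m)%N -> finite_set D ->
  (forall A, Pr (stays_in (skeleton m Y) A `\` stays_in Y A) = 0) ->
  blackwell_decomposition Pr (skeleton m Y) D -> D C -> almost_closed Pr Y C.
Proof.
move=> mY m0 finD null [[_ tD] acD _ _ sum1] DC.
have mYm : measurable_process (skeleton m Y) by move=> n i; exact: mY.
have mL A : measurable (stays_in Y A) by exact: measurable_stays_in.
have disj A B w : D A -> D B -> stays_in Y A w -> visits_io Y B w -> A = B.
  move=> DA DB Aw Bw; apply: (tD) => //; apply: contrapT => /nonemptyPn AB0.
  have := @stays_in_visits_ioI _ _ _ Y A B w (conj Aw Bw).
  by rewrite AB0 visits_io0.
have PrL A : Pr (stays_in (skeleton m Y) A) = Pr (stays_in Y A).
  have : (Pr (stays_in (skeleton m Y) A) = Pr (stays_in (skeleton m Y) A `\` stays_in Y A)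
      + Pr (stays_in (skeleton m Y) A `&` stays_in Y A))%E.
    by apply: measureDI => //; exact: measurable_stays_in.
  by rewrite null add0e setIidr//; exact: stays_in_skeletonS.
have cover : Pr (\bigcup_(A in D) stays_in Y A) = 1%E.
  rewrite (@measure_fin_bigcup _ _ _ Pr)//.
    rewrite -sum1 -esum_fset//; first by apply: eq_esum => A _; rewrite PrL.
  move=> A B DA DB [w [Aw Bw]]; apply: disj Aw _ => //.
  exact: stays_in_visits_io.
split.
  have mU : measurable (\bigcup_(A in D) stays_in Y A).
    exact: fin_bigcup_measurable.
  apply: (@subset_measure0 _ _ _ Pr _ (~` \bigcup_(A in D) stays_in Y A)).
  - by apply: measurableD => //; exact: measurable_visits_io.
  - exact: measurableC.
  - move=> w [Cw nCw] [A DA Aw]; apply: nCw.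
    by rewrite -(disj A C w).
  - exact: probability1_setC.
move=> tC; have [_] := acD C DC; apply.
apply: (subset_measure0 _ _ _ tC); [exact: measurable_visits_io..|].
exact: visits_io_skeletonS.
Qed.

Lemma blackwell_numberP Y n : (0 < n)%N -> blackwell_number Pr Y = n%:R%:E ->
  exists s : seq (set S),
    [/\ uniq s, size s = n & blackwell_decomposition Pr Y [set` s]].
Proof.
move=> n0; rewrite /blackwell_number; set D := xget _ _.
rewrite /counting; case: asboolP => // finD -[/eqP]; rewrite eqr_nat => /eqP sD.
exists (finmap.enum_fset (fset_set D)); split=> //; first exact: finmap.fset_uniq.
rewrite (_ : [set` _] = D); last first.
  by apply/seteqP; split=> A /=; rewrite in_fset_set ?inE.
(* Without a decomposition [xget] returns [set0], whose cardinality 0 contradicts [0 < n]. *)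
move: sD; rewrite /D; case: xgetP => [_ -> //|_].
by rewrite fset_set0 /= => n0'; rewrite -n0' in n0.
Qed.

(** Two members [A] and [B] of the decomposition for the skeleton cut the single set [C] for [Y]
    into disjoint almost closed sets. This excludes [C] atomic; if [C] is nonatomic, an atomic
    member would give it an atomic subset. *)
Lemma simple_skeleton m Y : measurable_process Y -> (1 < m)%N -> simple Pr Y ->
  (forall C, Pr (stays_in (skeleton m Y) C `\` stays_in Y C) = 0) ->
  blackwell_number Pr (skeleton m Y) <> m%:R%:E.
Proof.
move=> mY m1 sY null; have m0 : (0 < m)%N by exact: ltnW.
move=> /(blackwell_numberP m0)[[|A [|B s]] [us ss bd]].
  by rewrite -ss in m1.
  by rewrite -ss in m1.
have := @blackwell_numberP Y 1 isT sY; rewrite /simple.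
move=> [[|C [|? ?]] [_ // _ bdC]].
set D := [set` _] in bd.
have [DA DB] : D A /\ D B by rewrite /D/= !inE !eqxx orbT.
have AB : A <> B by move: us; rewrite /= inE negb_or => /andP[/andP[/eqP]].
have acY E : D E -> almost_closed Pr Y E.
  exact: (blackwell_decomposition_skeleton mY m0 (finite_seq _) null bd).
have [_ acC _ naC sumC] := bdC.
have C1 : Pr (stays_in Y C) = 1%E.
  move: sumC; rewrite (_ : [set` _] = [set C]) ?esum_set1//.
  by apply/seteqP; split=> E; rewrite /= inE => /eqP.
have acCY E : D E -> almost_closed Pr Y (C `&` E).
  by move=> DE; apply: almost_closedI => //; exact: acY.
have [[_ tD] _ uniq_na _ _] := bd.
have [aC|/naC[|naCS _]] := pselect (atomic Pr Y C); first 2 last.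
(* At most one member is nonatomic, so [A] or [B] is atomic for the skeleton. Its trace on [C] is
   atomic for [Y], since a splitting for [Y] is also one for the skeleton. *)
- have [E [DE [acE nE]]] : exists E, D E /\ atomic Pr (skeleton m Y) E.
    apply: contrapT => nex; apply: AB; apply: uniq_na => // aE; apply: nex.
      by exists A.
    by exists B.
  have /naCS : C `&` E `<=` C by move=> i [].
  move=> naCE; apply: naCE; split; first exact: acCY.
  move=> [F [G [acF acG FCE GCE FG0]]]; apply: nE; exists F, G; split=> //.
  - exact: almost_closed_skeleton.
  - exact: almost_closed_skeleton.
  - by move=> i /FCE[].
  - by move=> i /GCE[].
- case: aC => _; apply; exists (C `&` A), (C `&` B); split; try exact: acCY.
  + by move=> i [].
  + by move=> i [].
  + apply: contrapT => /eqP/set0P[i [[_ Ai] [_ Bi]]]; apply: AB; apply: tD => //.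
    by exists i.
- by rewrite /= inE.
Qed.

End almost_closed_sets.

(** * Asymptotic aperiodicity *)

Theorem corollary5 (R : realType) (S : countType)
    (hS : infinite_set [set: S])
    (P : S -> S -> R)
    (hstoch : stochastic P) (hirr : irreducible P) (haper : aperiodic P)
    (d : measure_display) (Omega : measurableType d) (Pr : probability Omega R)
    (X : nat -> Omega -> S) (hX : markov_chain Pr P X)
    (hsimple : simple Pr X)
    (hdelta : exists2 delta : R,
       0 < delta & finite_set [set i : S | ~ (delta <= P i i)]) :
  asymptotically_aperiodic Pr X.
Proof.
have [delta d0 finF] := hdelta.
have X1 : skeleton 1 X = X by apply/funext => n; rewrite /skeleton muln1.
rewrite /asymptotically_aperiodic /asymptotic_period.
(* The supremum runs over a single value: 1 occurs by simplicity, and [simple_skeleton] excludes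
   every larger [m]. *)
rewrite (_ : [set m%:R%:E | m in _] = [set 1%E]) ?ereal_sup1//.
apply/seteqP; split=> z /=; last by move=> ->; exists 1%N => //; rewrite X1.
move=> [[|[|m]] [m0 bm] <-] //; exfalso; apply: simple_skeleton hsimple _ bm => //.
  by case: hX.
by move=> C; apply: (stays_in_skeleton (proj1 hstoch) hX C _ hS hirr d0 finF).
Qed.
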